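(* Let $\boldsymbol d=(d_1,\dots,d_n)$ be an $n$-tuple of integers with $d_1>d_2>\dots>d_n\ge 0$, let $m\ge n\ge 1$, let $x_1,\dots,x_m\in\mathbb{C}$ and $\boldsymbol y=(y_1,\dots,y_m)^T\in\mathbb{C}^m$, and let $A=(x_k^{d_j})_{k=1,\dots,m;\,j=1,\dots,n}\in\mathbb{C}^{m\times n}$. Let the partitions $\boldsymbol\lambda$ and $\boldsymbol\lambda[i]$ ($i=1,\dots,n$) be associated to $\boldsymbol d$ as in the context. Suppose that the normal equation $$A^*A\,\boldsymbol a=A^*\boldsymbol y$$ has a unique solution $\boldsymbol a=(a_1,\dots,a_n)^T\in\mathbb{C}^n$. Then this unique solution is given by $$a_i=\frac{\sum\limits_{j=1}^n(-1)^{i+j}\left(\sum\limits_{\boldsymbol l\in\binom{[m]}{n-1}}s_{\boldsymbol\lambda[i]}(\boldsymbol x_{\boldsymbol l})\,\overline{s_{\boldsymbol\lambda[j]}(\boldsymbol x_{\boldsymbol l})}\,|V(\boldsymbol x_{\boldsymbol l})|^2\right)\left(\sum\limits_{k=1}^m\overline{x}_k^{\,d_j}y_k\right)}{\sum\limits_{\boldsymbol k\in\binom{[m]}{n}}|s_{\boldsymbol\lambda}(\boldsymbol x_{\boldsymbol k})V(\boldsymbol x_{\boldsymbol k})|^2}$$ for $i=1,\dots,n$. In particular, if there are at least $n$ distinct positive real values among $x_1,\dots,x_m$, then the normal equation $A^*A\,\boldsymbol a=A^*\boldsymbol y$ has a unique solution.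
   Context: $A^*=\overline{A}^T$ denotes the Hermitian transpose, and $x^0=1$ for all $x\in\mathbb{C}$ (including $x=0$). For a positive integer $r$ put $\boldsymbol\delta(r)=(r-1,r-2,\dots,1,0)$. For $\boldsymbol z=(z_1,\dots,z_r)\in\mathbb{C}^r$ let $V(\boldsymbol z)=\prod_{1\le i<j\le r}(z_i-z_j)$ be the Vandermonde determinant. For a partition $\boldsymbol\mu=(\mu_1,\dots,\mu_r)$, i.e. integers $\mu_1\ge\dots\ge\mu_r\ge 0$, the Schur polynomial $s_{\boldsymbol\mu}$ in $r$ variables is the polynomial $$s_{\boldsymbol\mu}(\boldsymbol z)=\frac{\det\big(z_i^{\mu_j+r-j}\big)_{i,j=1,\dots,r}}{V(\boldsymbol z)}$$ (the numerator is divisible by $V$ as a polynomial, and $s_{\boldsymbol\mu}$ is evaluated as a polynomial, also at points with coinciding coordinates). For $r=0$ the Schur polynomial of the empty partition and $V$ are both equal to $1$. Partitions associated to $\boldsymbol d$: $\boldsymbol\lambda=\boldsymbol d-\boldsymbol\delta(n)$, i.e. $\lambda_k=d_k+k-n$ for $k=1,\dots,n$. For $i=1,\dots,n$ let $\boldsymbol d\langle i\rangle=(d_1,\dots,d_{i-1},d_{i+1},\dots,d_n)$ be the tuple with $d_i$ removed, and $\boldsymbol\lambda[i]=\boldsymbol d\langle i\rangle-\boldsymbol\delta(n-1)$, a partition with $n-1$ entries (the empty partition if $n=1$). $[m]=\{1,\dots,m\}$, and $\binom{[m]}{r}$ is the collection of all $r$-element subsets of $[m]$; an element $\boldsymbol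 k\in\binom{[m]}{r}$ is written as $\boldsymbol k=(k_1,\dots,k_r)$ with $k_1<\dots<k_r$, and $\boldsymbol x_{\boldsymbol k}=(x_{k_1},\dots,x_{k_r})$. *)

(* Defs.v *)
From mathcomp Require Import all_boot all_order all_algebra.
From mathcomp Require Import mpoly.

Set Implicit Arguments.
Unset Strict Implicit.
Unset Printing Implicit Defensive.

Import GRing.Theory.
Local Open Scope ring_scope.

(* Indices are 0-based, so delta r i = r - 1 - i is the entry r - k of
   (r-1, ..., 1, 0) at position k = i + 1. *)

Definition delta (r : nat) (i : 'I_r) : nat := (r.-1 - i)%N.

Definition vandermonde (R : comNzRingType) (r : nat) (z : 'I_r -> R) : R :=
  \prod_(i < r) \prod_(j < r | (i < j)%N) (z i - z j).

Definition alternant (R : comNzRingType) (r : nat) (mu : 'I_r -> nat)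
    (z : 'I_r -> R) : R :=
  \det (\matrix_(i < r, j < r) z i ^+ (mu j + delta j)).

(* Truncated subtraction loses nothing here: if d is strictly decreasing, then
   delta i <= d i for every i. *)
Definition partition_of (r : nat) (d : 'I_r -> nat) (i : 'I_r) : nat :=
  (d i - delta i)%N.

Definition tuple_del (n : nat) (d : 'I_n -> nat) (i : 'I_n) (j : 'I_n.-1) : nat :=
  d (lift i j).

(* The subfamily of x indexed by k, in increasing order of indices; the default
   0 of nth is never used when k has r elements. *)
Definition subfam (R : nmodType) (m r : nat) (x : 'I_m -> R) (k : {set 'I_m})
    (i : 'I_r) : R :=
  nth 0 [seq x j | j <- enum k] i.

Section SchurExists.

Variables (R : idomainType) (r : nat).
Implicit Types (p q : {mpoly R[r]}) (i j : 'I_r).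

Let subst i j (k : 'I_r) : 'I_r := if k == j then i else k.
Let sub_tuple i j : r.-tuple {mpoly R[r]} := [tuple 'X_(subst i j k) | k < r].

Let sub_tupleX i j k : ('X_k : {mpoly R[r]}) \mPo sub_tuple i j = 'X_(subst i j k).
Proof. by rewrite comp_mpolyXU -tnth_nth tnth_mktuple. Qed.

Let congr_subst i j p :
  exists q, p - (p \mPo sub_tuple i j) = q * ('X_i - 'X_j).
Proof.
pose C (a b : {mpoly R[r]}) := exists q, a - b = q * ('X_i - 'X_j).
have CD a b c d : C a b -> C c d -> C (a + c) (b + d).
  by move=> [q e] [q' e']; exists (q + q'); rewrite mulrDl -e -e' opprD addrACA.
have CM a b c d : C a b -> C c d -> C (a * c) (b * d).
  move=> [q e] [q' e']; exists (q * c + b * q').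
  by rewrite mulrDl mulrAC -e -mulrA -e' mulrBl mulrBr addrA subrK.
have CC a : C a a by exists 0; rewrite subrr mul0r.
rewrite -/(C p _) comp_mpolyE {1}[p]mpolyE.
elim/big_ind2: _ => [|a b c d|mo _]; [exact: CC | exact: CD | ].
rewrite -!mul_mpolyC; apply: (CM) (CC _) _; rewrite mpolyXE_id.
elim/big_ind2: _ => [|a b c d|k _]; [exact: CC | exact: CM | ].
rewrite tnth_mktuple; elim: (mo k) => [|e IH]; first exact: CC.
rewrite !exprS; apply: CM IH; rewrite /subst; case: eqP => [->|_]; last exact: CC.
by exists (-1); rewrite mulN1r opprB.
Qed.

Let mpolyU_neq i j : i != j -> ('X_i : {mpoly R[r]}) - 'X_j != 0.
Proof.
move=> ne; rewrite subr_eq0; apply: contra ne => /eqP /(congr1 (mcoeff U_(i))).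
rewrite !mcoeffX eqxx => /eqP.
case: (eqVneq U_(j)%MM U_(i)%MM) => [/(congr1 (fun m : 'X_{1..r} => m i))|_].
  by rewrite !mnm1E eqxx; case: (eqVneq j i) => // ->.
by rewrite oner_eq0.
Qed.

Let dvd_pairs (s : seq ('I_r * 'I_r)) p :
    uniq s -> all (fun u : 'I_r * 'I_r => (u.1 < u.2)%N) s ->
    (forall u, u \in s -> p \mPo sub_tuple u.1 u.2 = 0) ->
  exists q, p = q * \prod_(u <- s) ('X_u.1 - 'X_u.2).
Proof.
elim: s => [_ _ _|[i j] s IH /=]; first by exists p; rewrite big_nil mulr1.
case/andP=> nin us /andP [ltij alls] kill.
have {IH} [q eq_p] : exists q, p = q * \prod_(u <- s) ('X_u.1 - 'X_u.2).
  by apply: IH => // u us'; apply: kill; rewrite inE us' orbT.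
have := kill (i, j); rewrite mem_head => /(_ isT) /=.
rewrite {1}eq_p rmorphM rmorph_prod /= => /eqP; rewrite mulf_eq0 => /orP [|].
  have [q' eq_q] := congr_subst i j q => /eqP q0; exists q'.
  by rewrite eq_p big_cons mulrA /= -eq_q q0 subr0.
rewrite prodf_seq_eq0 => /hasP [[k l] kls] /=.
have /= ltkl := allP alls _ kls; rewrite rmorphB /= !sub_tupleX.
have nkl : (k, l) != (i, j) by apply: contraNneq nin => <-.
suff ne : subst i j k != subst i j l by rewrite (negbTE (mpolyU_neq ne)).
rewrite /subst.
have [ekj|_] := eqVneq k j; have [elj|_] := eqVneq l j.
- by move: ltkl; rewrite ekj elj ltnn.
- by apply/eqP => eil; move: ltkl; rewrite ekj -eil ltnNge (ltnW ltij).
- by apply: contraNneq nkl => ->; rewrite elj.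
- by rewrite neq_ltn ltkl.
Qed.

Let alternant_subst mu i j : i != j ->
  alternant mu (fun k => 'X_k : {mpoly R[r]}) \mPo sub_tuple i j = 0.
Proof.
move=> ne; rewrite /alternant -det_map_mx.
apply: (determinant_alternate ne) => k; rewrite !mxE !rmorphXn /= !sub_tupleX.
by rewrite /subst eqxx (negbTE ne).
Qed.

Lemma schur_poly_exists (mu : 'I_r -> nat) :
  exists p : {mpoly R[r]},
    p * vandermonde (fun i => 'X_i) == alternant mu (fun i => 'X_i).
Proof.
pose s := enum [pred u : 'I_r * 'I_r | (u.1 < u.2)%N].
have [||u|q ->] := @dvd_pairs s (alternant mu (fun i => 'X_i)).
- exact: enum_uniq.
- by apply/allP => u; rewrite mem_enum.
- by rewrite mem_enum inE => lt; apply: alternant_subst; rewrite neq_ltn lt.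
by exists q; rewrite /vandermonde pair_big_dep /= big_enum.
Qed.

End SchurExists.

(* {mpoly R[r]} is an integral domain and the Vandermonde polynomial is nonzero,
   so the quotient chosen here is the only one. *)
Definition schur_poly (R : idomainType) (r : nat) (mu : 'I_r -> nat) :
    {mpoly R[r]} :=
  xchoose (schur_poly_exists R mu).

Definition schur (R : idomainType) (r : nat) (mu : 'I_r -> nat)
    (z : 'I_r -> R) : R :=
  (schur_poly R mu).@[z].

Lemma schurE (R : idomainType) (r : nat) (mu : 'I_r -> nat) (z : 'I_r -> R) :
  schur mu z * vandermonde z = alternant mu z.
Proof.
have /eqP/(congr1 (meval z)) := xchooseP (schur_poly_exists R mu).
rewrite -/(schur_poly R mu) mevalM -/(schur mu z) => eqS.
have evV : (vandermonde (fun i => 'X_i : {mpoly R[r]})).@[z] = vandermonde z.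
  rewrite rmorph_prod; apply: eq_bigr => i _.
  by rewrite rmorph_prod; apply: eq_bigr => j _; rewrite /= mevalB !mevalXU.
rewrite -evV eqS /alternant -det_map_mx; congr (\det _).
by apply/matrixP => i j; rewrite !mxE rmorphXn /= mevalXU.
Qed.

(* Main.v *)
Require Import Defs.
From mathcomp Require Import all_boot all_order all_algebra.
From mathcomp Require Import perm reals complex polyrcf.

Set Implicit Arguments.
Unset Strict Implicit.
Unset Printing Implicit Defensive.

Import Order.TTheory GRing.Theory Num.Theory.
Local Open Scope ring_scope.
Local Open Scope sesquilinear_scope.

(* By Cramer's rule a_i is the quotient by det (A^* A) of a sum of cofactors, and
   deleting row j and column i of A^* A leaves (A without column j)^* times
   (A without column i).  Cauchy-Binet expands the determinants of both kinds of
   Gram matrix into products of maximal minors, which are alternants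
   det (x_k ^ d_j), that is, Schur polynomials times Vandermonde determinants.
   Uniqueness for n distinct positive nodes holds because a nonzero vector in the
   kernel of A would give a nonzero polynomial with at most n terms and n
   positive roots. *)

(** * The Cauchy-Binet formula *)

(** Multilinearity expands the left side over all maps [f] from row indices to ['I_m]. Non-injective
    maps repeat a row of [B] and contribute zero; injective ones are grouped by their image [k],
    each being a permutation followed by the increasing enumeration of [k]. *)
Lemma cauchy_binet (R : comNzRingType) (r m : nat) (i0 : 'I_m)
    (A : 'M[R]_(r, m)) (B : 'M[R]_(m, r)) :
  \det (A *m B) = \sum_(k : {set 'I_m} | #|k| == r)
    \det (colsub (fun i : 'I_r => nth i0 (enum k) i) A) *
    \det (rowsub (fun i : 'I_r => nth i0 (enum k) i) B).
Proof.
pose D (f : {ffun 'I_r -> 'I_m}) := \det (rowsub f B) * \prod_i A i (f i).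
transitivity (\sum_(f : {ffun 'I_r -> 'I_m}) D f).
  pose AB (s : 'S_r) i l := A i l * B l (s i).
  transitivity (\sum_(f : {ffun 'I_r -> 'I_m})
      \sum_(s : 'S_r) (-1) ^+ s * \prod_i AB s i (f i)).
    rewrite exchange_big; apply: eq_bigr => /= s _; rewrite -big_distrr /=.
    congr (_ * _); rewrite -(bigA_distr_bigA (AB s)) /=.
    by apply: eq_bigr => i _; rewrite mxE.
  apply: eq_bigr => f _; rewrite /D mulrC big_distrr /=.
  apply: eq_bigr => s _; rewrite mulrCA big_split //=; congr (_ * (_ * _)).
  by apply: eq_bigr => i _; rewrite mxE.
rewrite (bigID (fun f : {ffun 'I_r -> 'I_m} => injectiveb f)) /= addrC big1 ?add0r.
  rewrite (partition_big (fun f : {ffun 'I_r -> 'I_m} => [set f i | i in 'I_r])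
             (fun k : {set 'I_m} => #|k| == r)) /=; last first.
    by move=> f /injectiveP injf; rewrite card_imset ?card_ord.
  apply: eq_bigr => k /eqP card_k; set g := fun i : 'I_r => nth i0 (enum k) i.
  have size_k : size (enum k) = r by rewrite -cardE.
  have g_inj : injective g.
    move=> i j /eqP; rewrite nth_uniq ?size_k ?enum_uniq //.
    by move/eqP/val_inj.
  have g_mem i : g i \in k by rewrite -mem_enum mem_nth ?size_k.
  have g_img (s : 'S_r) : [set g (s i) | i in 'I_r] = k.
    apply/eqP; rewrite eqEcard card_imset ?card_ord ?card_k ?leqnn ?andbT.
      by apply/subsetP => _ /imsetP [i _ ->].
    by move=> i j /g_inj /perm_inj.
  rewrite (reindex (fun s : 'S_r => [ffun i => g (s i)])) /=; last first.
    (* [h f] records the position of [f i] in the enumeration of [k], which inverts the passage from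
       [s] to [g (s i)]. When [f] has image [k], positions are below [r] and the default of [insubd]
       is never reached. *)
    pose h (f : {ffun 'I_r -> 'I_m}) :=
      [ffun i => insubd i (index (f i) (enum k)) : 'I_r].
    have hK (f : {ffun 'I_r -> 'I_m}) : [set f i | i in 'I_r] = k ->
        forall i, g (h f i) = f i.
      move=> imf i; have fik : f i \in enum k by rewrite mem_enum -imf imset_f.
      have lt_r : (index (f i) (enum k) < r)%N by rewrite -[ltnRHS]size_k index_mem.
      by rewrite ffunE /g val_insubd lt_r nth_index.
    have permK (f : {ffun 'I_r -> 'I_r}) :
        injective f -> forall i, (insubd (1%g : 'S_r) f) i = f i.
      move=> injf i; rewrite -pvalE -[pval _]/(val _) insubdK //.
      exact/injectiveP.
    have h_inj (f : {ffun 'I_r -> 'I_m}) :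
        [set f i | i in 'I_r] = k -> injective f -> injective (h f).
      by move=> imf injf i j /(congr1 g); rewrite !hK // => /injf.
    exists (fun f => insubd (1%g : 'S_r) (h f)) => [s _ | f].
      have gs_inj : injective [ffun i => g (s i)].
        by move=> i j; rewrite !ffunE => /g_inj /perm_inj.
      have gs_img : [set [ffun i => g (s i)] i | i in 'I_r] = k.
        by rewrite -[RHS](g_img s); apply: eq_imset => j; rewrite ffunE.
      apply/permP => i; rewrite permK; last exact: h_inj.
      by apply: g_inj; rewrite hK // ffunE.
    case/andP=> /injectiveP injf /eqP imf; apply/ffunP => i.
    by rewrite ffunE permK ?hK //; exact: h_inj.
  rewrite [X in X * _]/determinant big_distrl /=; apply: eq_big => [s|s _].
    apply/andP; split.
      by apply/injectiveP => i j; rewrite !ffunE => /g_inj /perm_inj.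
    by apply/eqP; rewrite -[RHS](g_img s); apply: eq_imset => j; rewrite ffunE.
  (* Composing with [s] permutes the rows of the minor of [B]; the resulting sign completes the
     Leibniz expansion of the minor of [A]. *)
  rewrite /D; have -> : rowsub [ffun i => g (s i)] B = perm_mx s *m rowsub g B.
    by rewrite -row_permE; apply/matrixP => i j; rewrite !mxE ffunE.
  rewrite det_mulmx det_perm mulrAC; congr (_ * _ * _).
  by apply: eq_bigr => i _; rewrite !mxE ffunE.
move=> f /injectivePn [i1 [i2 ne eqf]].
by rewrite /D (determinant_alternate ne) ?mul0r // => j; rewrite !mxE eqf.
Qed.

(** * Positive roots of sparse real polynomials *)

(** Rolle's theorem gives one root in each gap of the sorted list. Starting the path of [t] at [a]
    keeps these roots positive when [a] is. *)
Lemma deriv_roots_between (R : rcfType) (p : {poly R}) (a : R) (s : seq R) :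
    path <%R a s -> all (root p) (a :: s) ->
  exists t, [/\ size t = size s, path <%R a t & all (root p^`()) t].
Proof.
elim: s a => [|b s IH] a /=; first by exists [::].
case/andP=> ltab pbs /and3P [/rootP pa pb ps].
have [|t [szt pt rt]] := IH b pbs; first by rewrite /= pb ps.
have [|c] := @poly_rolle _ a b p ltab.
  by rewrite pa (rootP pb).
rewrite in_itv /= => /andP [ltac ltcb] /rootP p'c.
exists (c :: t); split=> /=; rewrite ?szt ?p'c //.
by case: t pt {szt rt} => [|e t] //=; rewrite ltac // => /andP [/(lt_trans ltcb) -> ->].
Qed.

(* A weak form of Descartes' rule of signs: dividing by 'X if the constant term
   vanishes, and differentiating otherwise, reduces the degree; the second step
   loses one term and, by Rolle, at most one root. *)
Lemma positive_roots_lt_terms (R : rcfType) (n : nat) (p : {poly R}) (s : seq R) :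
    (size p <= n)%N -> p != 0 ->
    uniq s -> all (fun x => 0 < x) s -> all (root p) s ->
  (size s < \sum_(i < n) (p`_i != 0)%R)%N.
Proof.
elim: n p s => [|n IH] p s szp p0 us poss rs.
  by move: p0; rewrite -size_poly_leq0 szp.
rewrite big_ord_recl /=.
have [c0|c0] := eqVneq p`_0 0.
  have [q def_p] : exists q, p = q * 'X.
    have /factor_theorem [q] : root p 0 by rewrite rootE horner_coef0 c0.
    by rewrite subr0; exists q.
  rewrite add0n (eq_bigr (fun i : 'I_n => nat_of_bool (q`_i != 0))); last first.
    by move=> i _; rewrite def_p coefMX.
  have q0 : q != 0 by apply: contraNneq p0 => q0; rewrite def_p q0 mul0r.
  apply: IH => //; first by move: szp; rewrite def_p size_mulX.
  apply/allP => x xs; have := allP rs x xs; rewrite def_p rootM => /orP [//|].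
  by rewrite rootX gt_eqF // (allP poss).
have coef_p' i : (p^`()`_i != 0) = (p`_i.+1 != 0) by rewrite coef_deriv mulrn_eq0.
rewrite add1n ltnS.
rewrite (eq_bigr (fun i : 'I_n => nat_of_bool (p^`()`_i != 0))); last first.
  by move=> i _; rewrite coef_p'.
(* If the derivative vanishes, [p] is a nonzero constant without roots, so [s] is empty. *)
have [p'0|p'0] := eqVneq p^`() 0.
  have def_p : p = (p`_0)%:P.
    apply/polyP => -[|i]; rewrite coefC //=.
    by apply/eqP/negPn; rewrite -coef_p' p'0 coef0 eqxx.
  case: s {us poss} rs => [|x s] //= /andP [].
  by rewrite def_p rootC (negbTE c0).
pose s' := sort <=%R s.
have mem_s' : s' =i s by exact: mem_sort.
have rs' : all (root p) s' by rewrite (eq_all_r mem_s').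
have poss' : all (fun x => 0 < x) s' by rewrite (eq_all_r mem_s').
have : sorted <%R s' by rewrite sort_lt_sorted.
rewrite -(size_sort <=%R s) -/s'; case: s' poss' rs' {mem_s'} => [|a t] //=.
move=> /andP [a0 _] rt pt; have [u [<- pu ru]] := deriv_roots_between pt rt.
apply: IH => //.
- by rewrite -ltnS (leq_trans (lt_size_deriv p0)).
- exact: sorted_uniq lt_trans ltxx _ (path_sorted pu).
- by apply: sub_all (order_path_min lt_trans pu) => z; exact: lt_trans.
Qed.

(** The polynomial with coefficients [c j] at exponents [d j] has at most [n] terms, so [n] positive
    roots force it to be zero; injectivity of [d] makes each [c j] one of its coefficients. *)
Lemma sparse_sum_eq0 (R : rcfType) (n : nat) (d : 'I_n -> nat) (c : 'I_n -> R)
    (s : seq R) :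
    injective d -> uniq s -> all (fun x => 0 < x) s -> (n <= size s)%N ->
    (forall x, x \in s -> \sum_(j < n) c j * x ^+ d j = 0) ->
  forall j, c j = 0.
Proof.
move=> injd us poss le_ns zs; pose p := \sum_(j < n) c j *: 'X^(d j).
have coefp i : p`_i = \sum_(j < n) c j * (i == d j)%:R.
  by rewrite coef_sum; apply: eq_bigr => j _; rewrite coefZ coefXn.
suff p0 : p = 0.
  move=> j; have := coefp (d j); rewrite p0 coef0 (bigD1 j) //= eqxx mulr1 big1.
    by rewrite addr0.
  by move=> k ne; rewrite (inj_eq injd) eq_sym (negbTE ne) mulr0.
apply/eqP; apply: contraLR le_ns => p0; rewrite -ltnNge.
have rs : all (root p) s.
  apply/allP => x xs; apply/rootP; rewrite -[RHS](zs x xs) horner_sum.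
  by apply: eq_bigr => j _; rewrite hornerZ hornerXn.
apply: leq_trans (positive_roots_lt_terms (leqnn _) p0 us poss rs) _.
(* Double counting: a nonzero coefficient at [i] needs some [j] with [d j = i], and each [j] serves
   at most one [i]. *)
apply: (@leq_trans (\sum_(i < size p) \sum_(j < n) (i == d j :> nat))).
  apply: leq_sum => i _; case: (boolP (p`_i != 0)) => // pi0; rewrite lt0n.
  apply: contraNneq pi0 => /eqP; rewrite sum_nat_eq0 => /forall_inP z.
  by rewrite coefp big1 // => j _; rewrite (eqP (z j isT)) mulr0.
rewrite exchange_big /= -[leqRHS]card_ord -sum1_card; apply: leq_sum => j _.
have [lt|le] := ltnP (d j) (size p).
  rewrite (bigD1 (Ordinal lt)) //= eqxx big1 ?addn0 // => i ne.
  by rewrite -val_eqE /= in ne; rewrite (negbTE ne).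
by rewrite big1 // => i _; rewrite ltn_eqF // (leq_trans _ le).
Qed.

(** * Gram determinants in terms of Schur polynomials *)

(** Going backwards from the last index, [delta] grows by exactly one per step and [d] by at least
    one, so the truncated subtraction is exact. *)
Lemma partition_ofK (r : nat) (d : 'I_r -> nat) :
    (forall i j : 'I_r, (i < j)%N -> (d j < d i)%N) ->
  forall i, (partition_of d i + delta i)%N = d i.
Proof.
move=> decr i; rewrite subnK //.
have [k] := ubnP (delta i); elim: k i => // k IH i; rewrite ltnS => le_k.
have [->//|pos] := posnP (delta i).
have lt_r : (i.+1 < r)%N by move: pos; rewrite subn_gt0 ltn_predRL.
have def_di : delta i = (delta (Ordinal lt_r)).+1.
  by rewrite /delta /= subnS prednK.
rewrite def_di; apply: leq_ltn_trans (decr i (Ordinal lt_r) (leqnn _)).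
by apply: IH; rewrite -def_di.
Qed.

Lemma schur_partition_of (R : idomainType) (r : nat) (d : 'I_r -> nat)
    (z : 'I_r -> R) :
    (forall i j : 'I_r, (i < j)%N -> (d j < d i)%N) ->
  schur (partition_of d) z * vandermonde z = \det (\matrix_(i, j) z i ^+ d j).
Proof.
move=> decr; rewrite schurE; congr (\det _).
by apply/matrixP => i j; rewrite !mxE partition_ofK.
Qed.

Lemma tuple_del_decr (n : nat) (d : 'I_n -> nat) (i : 'I_n) :
    (forall j k : 'I_n, (j < k)%N -> (d k < d j)%N) ->
  forall j k : 'I_n.-1, (j < k)%N -> (tuple_del d i k < tuple_del d i j)%N.
Proof. by move=> decr j k lt; apply: decr; rewrite ltnNge leq_bump2 -ltnNge. Qed.

(** In each Cauchy-Binet term the left minor is a conjugated alternant for [d] and the right one an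
    alternant for [e]; their Vandermonde factors combine into a squared modulus. *)
Lemma det_gram (C : numClosedFieldType) (m r : nat) (x : 'I_m -> C)
    (d e : 'I_r -> nat) :
    (0 < m)%N ->
    (forall i j : 'I_r, (i < j)%N -> (d j < d i)%N) ->
    (forall i j : 'I_r, (i < j)%N -> (e j < e i)%N) ->
  \det ((\matrix_(k < m, j < r) x k ^+ d j) ^t* *m
        (\matrix_(k < m, j < r) x k ^+ e j)) =
  \sum_(k : {set 'I_m} | #|k| == r)
    schur (partition_of e) (subfam x k) *
    (schur (partition_of d) (subfam x k))^* *
    `|vandermonde (subfam x k : 'I_r -> C)| ^+ 2.
Proof.
move=> m_gt0 decr_d decr_e; pose i0 := Ordinal m_gt0.
rewrite (cauchy_binet i0); apply: eq_bigr => k /eqP card_k.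
have nthE (i : 'I_r) : x (nth i0 (enum k) i) = subfam x k i.
  by rewrite /subfam (nth_map i0) // -cardE card_k.
pose V := vandermonde (subfam x k : 'I_r -> C); rewrite -/V.
transitivity ((schur (partition_of d) (subfam x k) * V)^* *
  (schur (partition_of e) (subfam x k) * V)); last first.
  move: (schur _ _) (schur _ _) V => a b c.
  by rewrite normCK rmorphM /= mulrC mulrACA.
congr (_ * _); rewrite schur_partition_of //.
  rewrite -det_map_mx -[RHS]det_tr; congr (\det _).
  by apply/matrixP => i j; rewrite !mxE nthE.
by congr (\det _); apply/matrixP => i j; rewrite !mxE nthE.
Qed.

Lemma row'_col'_gram (C : numClosedFieldType) (m n : nat) (A : 'M[C]_(m, n)) i j :
  row' j (col' i (A ^t* *m A)) = (col' j A) ^t* *m col' i A.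
Proof.
by apply/matrixP => k l; rewrite !mxE; apply: eq_bigr => h _; rewrite !mxE.
Qed.

(** * Cramer's rule and unique solvability *)

Lemma cramer (F : fieldType) (n : nat) (G : 'M[F]_n) (a b : 'cV[F]_n) i :
  \det G != 0 -> G *m a = b ->
  a i 0 = (\sum_(j < n) (-1) ^+ (i + j)%N * \det (row' j (col' i G)) * b j 0) / \det G.
Proof.
move=> det0 <-; rewrite mulrC; apply: canRL (mulKf det0) _.
transitivity ((\adj G *m (G *m a)) i 0).
  by rewrite mulmxA mul_adj_mx mul_scalar_mx [RHS]mxE.
rewrite mxE; apply: eq_bigr => j _; congr (_ * _).
by rewrite [LHS]mxE /cofactor addnC.
Qed.

(** Adding a nonzero kernel vector to [a] would give a second solution. *)
Lemma unique_solution_det (F : fieldType) (n : nat) (G : 'M[F]_n) (a b : 'cV[F]_n) :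
  unique (fun v => G *m v = b) a -> \det G != 0.
Proof.
move=> [Ga uniq_a]; rewrite -det_tr; apply/det0P => -[v /eqP v0 Gv]; apply: v0.
have {}Gv : G *m v^T = 0 by apply: trmx_inj; rewrite trmx_mul trmxK Gv trmx0.
have := uniq_a (a + v^T); rewrite mulmxDr Gv addr0 => /(_ Ga) /eqP.
by rewrite -subr_eq0 opprD addrA subrr add0r oppr_eq0 => /eqP /(canRL trmxK); rewrite trmx0.
Qed.

Lemma det_solution_unique (F : fieldType) (n : nat) (G : 'M[F]_n) (b : 'cV[F]_n) :
  \det G != 0 -> exists! a, G *m a = b.
Proof.
rewrite -unitfE -unitmxE => Gu; exists (invmx G *m b).
by split=> [|v <-]; rewrite ?mulKVmx ?mulKmx.
Qed.

(** The squared norm of [v *m A ^t*] is [v *m (A ^t* *m A) *m v ^t*], which is zero. *)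
Lemma gram_ker (C : numClosedFieldType) (m n : nat) (A : 'M[C]_(m, n)) (v : 'rV_n) :
  v *m (A ^t* *m A) = 0 -> v *m A ^t* = 0.
Proof.
move=> vG; set w := v *m A ^t*.
have ww : \sum_k `|w 0 k| ^+ 2 = 0.
  transitivity ((w *m w ^t*) 0 0).
    by rewrite mxE; apply: eq_bigr => k _; rewrite !mxE normCK.
  rewrite {2}/w trmx_mul map_mxM /= trmxCK -/w mulmxA /w -(mulmxA v) vG.
  by rewrite mul0mx mxE.
apply/rowP => k; rewrite [RHS]mxE; apply/eqP; rewrite -normr_eq0 -sqrf_eq0.
by apply/eqP; apply: (psumr_eq0P _ ww) => // h _; exact: exprn_ge0.
Qed.

(** A vector [v] in the left kernel yields a sparse sum vanishing at the conjugated nodes; positive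
    nodes equal their conjugates. *)
Lemma det_gram_neq0 (R : rcfType) (m n : nat) (x : 'I_m -> R[i]) (d : 'I_n -> nat) :
    injective d -> (n <= size (undup [seq z <- codom x | (0 < z)%R]))%N ->
  let A := \matrix_(k < m, j < n) x k ^+ d j in \det (A ^t* *m A) != 0.
Proof.
move=> injd; set t := undup _ => le_nt /=.
set A := (\matrix_(k, j) _); apply/det0P => -[v /eqP v0 /gram_ker vA].
have mem_t z : z \in t = (0 < z) && (z \in codom x) by rewrite mem_undup mem_filter.
have ReK z : z \in t -> (complex.Re z)%:C%C = z.
  by rewrite mem_t => /andP [/gtr0_real /RRe_real].
have zero_t z : z \in t -> \sum_(j < n) v 0 j * z ^+ d j = 0.
  rewrite mem_t => /andP [z_gt0 /codomP [k def_z]].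
  transitivity ((v *m A ^t*) 0 k); last by rewrite vA mxE.
  rewrite [RHS]mxE; apply: eq_bigr => j _; rewrite !mxE rmorphXn /= -def_z.
  by rewrite (CrealP (gtr0_real z_gt0)).
(* The root bound is real while [v] is complex: [f] will be the real part, then the imaginary
   part. *)
have part (f : R[i] -> R) : f 0 = 0 -> {morph f : a b / a + b} ->
    (forall a (r : R), f (a * r%:C%C) = f a * r) -> forall j, f (v 0 j) = 0.
  move=> f0 fD fM; apply: (sparse_sum_eq0 (s := map (@complex.Re R) t) injd).
  - by rewrite map_inj_in_uniq ?undup_uniq // => a b /ReK {2}<- /ReK {2}<- ->.
  - by apply/allP => _ /mapP [z zt ->]; rewrite -ltcR ReK //; move: zt; rewrite mem_t => /andP [].
  - by rewrite size_map.
  move=> _ /mapP [z zt ->]; rewrite -[RHS]f0 -(zero_t z zt).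
  rewrite (big_morph f fD f0); apply: eq_bigr => j _.
  by rewrite -{2}(ReK z zt) -rmorphXn fM.
apply: v0; apply/rowP => j; rewrite mxE; apply/eqP.
rewrite eq_complex; apply/andP; split; apply/eqP.
  by apply: part => // [[a b] [a' b']|[a b] r] //=; rewrite mulr0 subr0.
by apply: part => // [[a b] [a' b']|[a b] r] //=; rewrite mulr0 add0r.
Qed.

(* In the order of R[i], [0 < z] means that z is real and positive. *)
Theorem theorem2p2 (R : realType) (n m : nat) (d : 'I_n -> nat)
    (x : 'I_m -> R[i]) (y : 'cV[R[i]]_m)
    (n_gt0 : (0 < n)%N) (le_nm : (n <= m)%N)
    (d_decr : forall i j : 'I_n, (i < j)%N -> (d j < d i)%N) :
  let A : 'M[R[i]]_(m, n) := \matrix_(k < m, j < n) x k ^+ d j in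
  let normal_eq (a : 'cV[R[i]]_n) := A ^t* *m A *m a = A ^t* *m y in
  let lambda := partition_of d in
  let lambda_del (i : 'I_n) := partition_of (tuple_del d i) in
  let denom : R[i] :=
    \sum_(k : {set 'I_m} | #|k| == n)
      `|schur lambda (subfam x k) * vandermonde (subfam x k : 'I_n -> R[i])| ^+ 2 in
  let numer (i : 'I_n) : R[i] :=
    \sum_(j < n) (-1) ^+ (i + j)%N *
      (\sum_(l : {set 'I_m} | #|l| == n.-1)
         schur (lambda_del i) (subfam x l) *
         (schur (lambda_del j) (subfam x l))^* *
         `|vandermonde (subfam x l : 'I_n.-1 -> R[i])| ^+ 2) *
      (\sum_(k < m) (x k)^* ^+ d j * y k 0) in
  (forall a, unique normal_eq a ->
     denom != 0 /\ forall i, a i 0 = numer i / denom)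
  /\
  ((n <= size (undup [seq z <- codom x | (0 < z)%R]))%N ->
     exists! a, normal_eq a).
Proof.
have m_gt0 : (0 < m)%N := leq_trans n_gt0 le_nm.
have decr_del i := tuple_del_decr i d_decr.
move=> A normal_eq lambda lambda_del denom numer.
have denomE : \det (A ^t* *m A) = denom.
  rewrite /A det_gram //; apply: eq_bigr => k _.
  by rewrite normrM exprMn [in RHS]normCK.
split=> [a uniq_a|le_n].
  have det0 := unique_solution_det uniq_a.
  split=> [|i]; first by rewrite -denomE.
  rewrite (cramer i det0 uniq_a.1) denomE; congr (_ / _).
  apply: eq_bigr => j _; congr (_ * _ * _); last first.
    by rewrite mxE; apply: eq_bigr => k _; rewrite !mxE rmorphXn.
  (* Dropping a column of [A] leaves the power matrix of [tuple_del d], so each cofactor is a Gram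
     determinant with exponents [tuple_del d j] on the conjugated side. *)
  rewrite row'_col'_gram.
  apply: etrans (det_gram x m_gt0 (decr_del j) (decr_del i)).
  by congr (\det (map_mx _ _^T *m _)); apply/matrixP => k l; rewrite !mxE.
apply/det_solution_unique/det_gram_neq0 => // i j eq_d.
apply: val_inj; case: (ltngtP i j) => // lt; have := d_decr _ _ lt;
  by rewrite eq_d ltnn.
Qed.
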